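(* Let $x_0,y_0\in\mathbb{R}^n$ be distinct and suppose $u\in \mathcal{D}^{1,p}(\mathbb{R}^n)$ is an extremal with $$[u]_{C^{1-n/p}(\mathbb{R}^n)}=\frac{|u(x_0)-u(y_0)|}{|x_0-y_0|^{1-n/p}}.$$ Then $$u(x)=u(O (x-x_0)+x_0), \quad x\in \mathbb{R}^n,$$ for any orthogonal transformation $O$ of $\mathbb{R}^n$ which satisfies $O\left(y_0-x_0\right)=y_0-x_0$.
   Context: Throughout, $n\ge 1$ is an integer and $n<p<\infty$. $\mathcal{D}^{1,p}(\mathbb{R}^n)$ is the space of $u\in L^1_{\mathrm{loc}}(\mathbb{R}^n)$ whose weak first-order partial derivatives all belong to $L^p(\mathbb{R}^n)$. Every such $u$ has a Hölder continuous representative and is always identified with it. Put $[u]_{C^{1-n/p}(\mathbb{R}^n)}:=\sup_{x\ne y}\frac{|u(x)-u(y)|}{|x-y|^{1-n/p}}$ and $\|Du\|_{L^p(\mathbb{R}^n)}:=\left(\int_{\mathbb{R}^n}|Du|^p\,dx\right)^{1/p}$. Morrey's inequality says there is a finite constant $C$ with $[u]_{C^{1-n/p}(\mathbb{R}^n)}\le C\|Du\|_{L^p(\mathbb{R}^n)}$ for all $u\in\mathcal{D}^{1,p}(\mathbb{R}^n)$; $C_*$ denotes the sharp (smallest) such constant. An extremal is a function $u\in\mathcal{D}^{1,p}(\mathbb{R}^n)$ with $[u]_{C^{1-n/p}(\mathbb{R}^n)}=C_*\|Du\|_{L^p(\mathbb{R}^n)}$. *)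

(* Defs.v *)
From HB Require Import structures.
From mathcomp Require Import all_boot all_order all_algebra.
From mathcomp Require Import all_classical all_reals all_analysis.

Set Implicit Arguments.
Unset Strict Implicit.
Unset Printing Implicit Defensive.
Import Order.TTheory GRing.Theory Num.Theory.
Import numFieldNormedType.Exports.

Local Open Scope classical_set_scope.
Local Open Scope ring_scope.

Definition rV_display : measure_display -> measure_display.
Proof. exact. Qed.

(* 'rV[R]_n carries the sigma-algebra generated by the coordinates, i.e. the
   Borel sigma-algebra of R^n (the same construction as for n.-tuple). *)
Section measurable_rV.
Context (R : realType) (n : nat).

Let coords : 'I_n -> 'rV[R]_n -> R := fun i x => x ord0 i.

Let rV_set0 : g_sigma_preimage coords set0.
Proof. exact: sigma_algebra0. Qed.

Let rV_setC A : g_sigma_preimage coords A -> g_sigma_preimage coords (~` A).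
Proof. exact: sigma_algebraC. Qed.

Let rV_bigcup (F : (set 'rV[R]_n)^nat) :
  (forall i, g_sigma_preimage coords (F i)) ->
  g_sigma_preimage coords (\bigcup_i (F i)).
Proof. exact: sigma_algebra_bigcup. Qed.

HB.instance Definition _ := @isMeasurable.Build
  (rV_display default_measure_display)
  'rV[R]_n (g_sigma_preimage coords) rV_set0 rV_setC rV_bigcup.

End measurable_rV.

Section lebesgue_rV.
Context (R : realType).

Lemma measurable_rV_coord n (i : 'I_n) :
  measurable_fun [set: 'rV[R]_n] (fun x => x ord0 i).
Proof.
move=> _ Y mY; rewrite setTI; apply: sub_sigma_algebra => /=.
rewrite -bigcup_seq/=; exists i => /=; first by rewrite mem_index_enum.
by exists Y => //; rewrite setTI.
Qed.

Lemma measurable_fun_rV d (T : measurableType d) n (f : T -> 'rV[R]_n) :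
  (forall i, measurable_fun [set: T] (fun t => f t ord0 i)) ->
  measurable_fun [set: T] f.
Proof.
move=> mf.
have sub : g_sigma_preimage (fun (i : 'I_n) (x : 'rV[R]_n) => x ord0 i)
    `<=` [set A | measurable (f @^-1` A)].
  apply: smallest_sub.
    split => //=.
    - by rewrite preimage_set0.
    - by move=> A; rewrite setTD preimage_setC => /measurableC.
    - by move=> F mF; rewrite preimage_bigcup; exact: bigcupT_measurable.
  move=> A; rewrite -bigcup_seq/= => -[i _ [B mB <-]] /=.
  by rewrite setTI -[X in measurable X]setTI; exact: mf.
by move=> _ A /sub; rewrite setTI.
Qed.

Definition rV_cons n (x : measurableTypeR R * 'rV[R]_n) : 'rV[R]_n.+1 :=
  \row_i (if unlift ord0 i is Some j then x.2 ord0 j else x.1).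

Lemma rV_cons0 n (x : measurableTypeR R * 'rV[R]_n) :
  rV_cons x ord0 ord0 = x.1.
Proof. by rewrite mxE unlift_none. Qed.

Lemma rV_consS n (x : measurableTypeR R * 'rV[R]_n) (j : 'I_n) :
  rV_cons x ord0 (lift ord0 j) = x.2 ord0 j.
Proof. by rewrite mxE liftK. Qed.

Lemma measurable_rV_cons n : measurable_fun setT (@rV_cons n).
Proof.
apply: measurable_fun_rV => i; case: (unliftP ord0 i) => [j|] ->.
  under eq_fun do rewrite rV_consS.
  exact: (measurableT_comp (measurable_rV_coord j) measurable_snd).
by under eq_fun do rewrite rV_cons0; exact: measurable_fst.
Qed.

Section step.
Context (n : nat) (mu : {sigma_finite_measure set 'rV[R]_n -> \bar R}).

Definition lebesgue_rV_step : set 'rV[R]_n.+1 -> \bar R :=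
  pushforward (@lebesgue_measure R \x mu)%E (@rV_cons n).

(* Side condition of the library's measure instance on pushforward. *)
Let mcons : measurable_fun setT (@rV_cons n) := @measurable_rV_cons n.

Let step0 : lebesgue_rV_step set0 = 0%E.
Proof. exact: measure0. Qed.

Let step_ge0 A : (0 <= lebesgue_rV_step A)%E.
Proof. exact: measure_ge0. Qed.

Let step_sigma_additive : semi_sigma_additive lebesgue_rV_step.
Proof. exact: measure_semi_sigma_additive. Qed.

HB.instance Definition _ := isMeasure.Build _ _ _ lebesgue_rV_step
  step0 step_ge0 step_sigma_additive.

Let step_sigma_finite : sigma_finite setT lebesgue_rV_step.
Proof.
pose uncons (x : 'rV[R]_n.+1) : measurableTypeR R * 'rV[R]_n :=
  (x ord0 ord0, \row_j x ord0 (lift ord0 j)).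
have consK : cancel (@rV_cons n) uncons.
  move=> [a v]; congr pair; first exact: rV_cons0.
  by apply/rowP => j; rewrite mxE rV_consS.
have muncons : measurable_fun setT uncons.
  apply: measurable_fun_pair => /=; first exact: measurable_rV_coord.
  apply: measurable_fun_rV => j; under eq_fun do rewrite mxE.
  exact: measurable_rV_coord.
have /sigma_finiteP[F [TF ndF Foo]] := sigma_finiteT (@lebesgue_measure R).
have /sigma_finiteP[G [TG ndG Goo]] := sigma_finiteT mu.
exists (fun k => uncons @^-1` (F k `*` G k)).
  rewrite -preimage_bigcup [X in _ @^-1` X](_ : _ = setT)//.
  apply/seteqP; split => // -[a v] _.
  have [i _ Fa] : (\bigcup_k F k) a by rewrite -TF.
  have [j _ Gv] : (\bigcup_k G k) v by rewrite -TG.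
  exists (maxn i j) => //; split => /=.
    by move: a Fa; exact/subsetPset/ndF/leq_maxl.
  by move: v Gv; exact/subsetPset/ndG/leq_maxr.
move=> k; have [mF Fk] := Foo k; have [mG Gk] := Goo k; split.
  by rewrite -[X in measurable X]setTI; apply: muncons => //; exact: measurableX.
rewrite /lebesgue_rV_step /pushforward -comp_preimage.
rewrite (_ : uncons \o _ = id); last by apply/funext => x; exact: consK.
by rewrite preimage_id product_measure1E// lte_mul_pinfty// ge0_fin_numE.
Qed.

HB.instance Definition _ := Measure_isSigmaFinite.Build _ _ _ lebesgue_rV_step
  step_sigma_finite.

End step.

(* Lebesgue measure on R^n, by R^n.+1 = R * R^n. *)
Fixpoint lebesgue_rV n : {sigma_finite_measure set 'rV[R]_n -> \bar R} :=
  if n is m.+1 then lebesgue_rV_step (lebesgue_rV m) else \d_(0 : 'rV[R]_0).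

Lemma lebesgue_rV_box n (A : 'I_n -> set (measurableTypeR R)) :
  (forall i, measurable (A i)) ->
  lebesgue_rV n [set x | forall i, A i (x ord0 i)] =
  (\prod_(i < n) lebesgue_measure (A i))%E.
Proof.
elim: n A => [|n IH] A mA /=.
  by rewrite big_ord0 diracE mem_set// => -[].
rewrite big_ord_recl -IH; last by move=> i; exact: mA.
rewrite /lebesgue_rV_step /pushforward -product_measure1E//; last first.
  rewrite [X in _.-measurable X](_ : _ = \bigcap_(i in [set: 'I_n])
      ((fun x : 'rV[R]_n => x ord0 i) @^-1` A (lift ord0 i))).
    apply: fin_bigcap_measurable => // i _.
    rewrite -[X in measurable X]setTI.
    exact: (measurable_rV_coord i measurableT (mA _)).
  by apply/seteqP; split => x h i; [move=> _; exact: h|exact: (h i I)].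
congr (_ _); apply/seteqP; split => [[a v]/= h|[a v]/= [h0 h] i].
  split => [|i]; first by have := h ord0; rewrite rV_cons0.
  by have := h (lift ord0 i); rewrite rV_consS.
by case: (unliftP ord0 i) => [j|] ->; rewrite (rV_consS, rV_cons0).
Qed.

End lebesgue_rV.

Section euclidean.
Context (R : realType) (n : nat).
Implicit Types x y : 'rV[R]_n.

Definition dotv x y : R := \sum_(i < n) x ord0 i * y ord0 i.

(* The norm `|x| of 'rV[R]_n is the sup norm. *)
Definition enorm x : R := Num.sqrt (dotv x x).

Definition orthogonal_transformation (O : {linear 'rV[R]_n -> 'rV[R]_n}) :=
  forall x y, dotv (O x) (O y) = dotv x y.

End euclidean.

Section weak_derivatives.
Context (R : realType) (n : nat).
Implicit Types (f g phi u : 'rV[R]_n -> R) (G : 'rV[R]_n -> 'rV[R]_n).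

Local Notation mu := (@lebesgue_rV R n).

Definition partial (i : 'I_n) f : 'rV[R]_n -> R :=
  'D_(delta_mx ord0 i : 'rV[R]_n) f.

Definition smooth f :=
  forall (s : seq 'I_n) (x : 'rV[R]_n), differentiable (foldr partial f s) x.

Definition test_function phi :=
  smooth phi /\ compact (closure [set x | phi x != 0]).

Definition loc_integrable f :=
  measurable_fun setT f /\
  forall K : set 'rV[R]_n, compact K -> mu.-integrable K (EFin \o f).

Definition weak_partial (i : 'I_n) f g :=
  [/\ loc_integrable f, loc_integrable g &
   forall phi, test_function phi ->
     \int[mu]_x (f x * partial i phi x) = - \int[mu]_x (g x * phi x)].

Definition weak_gradient u G :=
  forall i, weak_partial i u (fun x => G x ord0 i).

End weak_derivatives.

Section morrey.
Context (R : realType) (n : nat) (p : R).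
Implicit Types (u : 'rV[R]_n -> R) (G : 'rV[R]_n -> 'rV[R]_n).

Local Notation mu := (@lebesgue_rV R n).

(* u is in D^{1,p}(R^n), with weak gradient Du = G, and is the continuous
   representative of its a.e. class.  Since G is determined up to a null set,
   [grad_norm G] depends on u only. *)
Definition D1p_gradient u G :=
  [/\ continuous u, loc_integrable u, weak_gradient u G &
      forall i, (fun x => G x ord0 i) \in Lfun mu p%:E].

Definition D1p u := exists G, D1p_gradient u G.

Definition grad_norm G : \bar R := ('N[mu]_(p%:E)[(fun x => (enorm (G x))%:E)])%E.

Definition hoelder_quotient u (x y : 'rV[R]_n) : R :=
  `|u x - u y| / enorm (x - y) `^ (1 - n%:R / p).

Definition hoelder_seminorm u : \bar R :=
  ereal_sup [set q | exists x y : 'rV[R]_n,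
                       x != y /\ q = (hoelder_quotient u x y)%:E].

Definition morrey_bound (C : R) :=
  forall u G, D1p_gradient u G ->
    (hoelder_seminorm u <= C%:E * grad_norm G)%E.

(* By Morrey's inequality, for n < p the set below is nonempty; it is closed and
   bounded below, so this infimum is the smallest admissible constant. *)
Definition morrey_constant : R := inf [set C | morrey_bound C].

Definition morrey_extremal u :=
  exists2 G, D1p_gradient u G &
    hoelder_seminorm u = (morrey_constant%:E * grad_norm G)%E.

End morrey.

(* Main.v *)
From HB Require Import structures.
Require Import Defs.
From mathcomp Require Import all_boot all_order all_algebra.
From mathcomp Require Import all_classical all_reals all_analysis.
From mathcomp Require Import measurable_realfun.
From mathcomp Require Import ring lra.
Import Order.TTheory GRing.Theory Num.Theory.
Import numFieldNormedType.Exports.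
Local Open Scope classical_set_scope.
Local Open Scope ring_scope.

(* Precomposing [u] with the rigid motion [x |-> Q (x - x0) + x0] gives [v] with
   the same Dirichlet energy and the same values at [x0] and [y0].  The midpoint
   [w = (u + v) / 2] still has [|w x0 - w y0| = |u x0 - u y0|], so Morrey's
   inequality forces the energy of [w] to be at least that of [u] and [v]; by
   strict convexity of [|.|^p] the gradients of [u] and [v] agree almost
   everywhere.  Morrey's inequality applied to [u - v] then makes [u - v]
   constant, and it vanishes at [x0].

   If [C_* > 0], the infimum defining it is over a nonempty set and is attained,
   so [C_*] is an admissible constant.  Otherwise (including the junk value [0]
   of [inf] on an empty set) [[u] = C_* ||Du|| <= 0] and [u] is constant. *)

(** * Translation invariance and proportionality of invariant measures *)

Section lebesgue_rV_invariance.
Context {R : realType}.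

(** A shifted half-open interval keeps its length, and these lengths determine the measure. *)
Lemma lebesgue_measure_translation (a : R) (A : set (measurableTypeR R)) :
  measurable A ->
  lebesgue_measure ((fun x => x + a) @^-1` A) = lebesgue_measure A.
Proof.
pose f : measurableTypeR R -> measurableTypeR R := fun x => x + a.
have mf : measurable_fun setT f by exact: measurable_funD.
move=> mA; apply/esym.
apply: (@lebesgue_measure_unique R (pushforward lebesgue_measure f)) =>
  //= _ [[l r]] _ <-.
rewrite /pushforward/=.
rewrite (_ : _ @^-1` _ = `]l - a, r - a]%classic); last first.
  by apply/seteqP; split=> x /=; rewrite !in_itv/= ltrBlDr lerBrDr.
by rewrite !lebesgue_measure_itv/= !lte_fin ltrD2r -!EFinD opprB addrA subrK.
Qed.

Lemma measurable_coord n d (T : measurableType d) (f : T -> 'rV[R]_n) i :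
  measurable_fun setT f -> measurable_fun setT (fun x => f x ord0 i).
Proof. exact: (measurableT_comp (measurable_rV_coord i)). Qed.

Lemma measurable_rVD n d (T : measurableType d) (f g : T -> 'rV[R]_n) :
  measurable_fun setT f -> measurable_fun setT g ->
  measurable_fun setT (fun x => f x + g x).
Proof.
move=> mf mg; apply: measurable_fun_rV => i; under eq_fun do rewrite mxE.
by apply: measurable_funD; exact: measurable_coord.
Qed.

Lemma measurable_mulmx m n (M : 'M[R]_(m, n)) :
  measurable_fun setT (fun x : 'rV[R]_m => x *m M).
Proof.
apply: measurable_fun_rV => j; under eq_fun do rewrite mxE.
apply: measurable_sum => i; apply: measurable_funM => //.
exact: measurable_rV_coord.
Qed.

Definition translation_invariant {n} (m : set 'rV[R]_n -> \bar R) :=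
  forall (b : 'rV[R]_n) (A : set 'rV[R]_n), measurable A ->
    m ((fun x => x + b) @^-1` A) = m A.

(** Induction on the dimension: through [rV_cons] a shift acts separately on the first coordinate
    and on the rest, and a measure with the right values on rectangles is the product measure. *)
Lemma lebesgue_rV_translation n : translation_invariant (lebesgue_rV R n).
Proof.
elim: n => [|n IH] b A mA.
  congr (lebesgue_rV R 0 _); apply/seteqP.
  by split=> x /=; rewrite [x + b]thinmx0 [x]thinmx0.
rewrite /= /lebesgue_rV_step/= /pushforward.
pose s (x : measurableTypeR R * 'rV[R]_n) : measurableTypeR R * 'rV[R]_n :=
  (x.1 + b ord0 ord0, x.2 + \row_j b ord0 (lift ord0 j)).
have ms : measurable_fun setT s.
  apply: measurable_fun_pair => /=; first exact: measurable_funD.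
  by apply: measurable_rVD => //; exact: measurable_snd.
have mB : measurable ((@rV_cons R n) @^-1` A).
  by rewrite -[X in measurable X]setTI; exact: measurable_rV_cons.
rewrite (_ : _ @^-1` _ = s @^-1` (@rV_cons R n @^-1` A)); last first.
  apply/seteqP; suff E x : rV_cons x + b = rV_cons (s x).
    by split=> x /=; rewrite E.
  apply/rowP => i; rewrite mxE; case: (unliftP ord0 i) => [j|] ->.
    by rewrite !rV_consS/= !mxE.
  by rewrite !rV_cons0.
apply/esym.
apply: (@product_measure_unique _ _ _ _ _ lebesgue_measure (lebesgue_rV R n)
  (pushforward (lebesgue_measure \x lebesgue_rV R n)%E s)) => // C D mC mD.
change ((lebesgue_measure \x lebesgue_rV R n)%E
  (((fun x => x + b ord0 ord0) @^-1` C) `*`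
   ((fun x => x + \row_j b ord0 (lift ord0 j)) @^-1` D)) =
  (lebesgue_measure C * lebesgue_rV R n D)%E).
rewrite product_measure1E//; last 2 first.
- rewrite -[X in measurable X]setTI.
  exact: (measurable_funD _ _).
- by rewrite -[X in measurable X]setTI; exact: measurable_rVD.
by congr (_ * _)%E; [exact: lebesgue_measure_translation|exact: IH].
Qed.

(** The Fubini argument behind uniqueness of Haar measure: for a fixed [B] it makes [m1 A] and
    [m2 A] proportional. A rectangle is sheared three times, each shear shifting the sections along
    a single factor. *)
Lemma product_translation_invariant n
    (m1 m2 : {sigma_finite_measure set 'rV[R]_n -> \bar R}) (A B : set 'rV[R]_n) :
  translation_invariant m1 -> translation_invariant m2 ->
  measurable A -> measurable B ->
  (m1 A * m2 B = m1 (-%R @^-1` B) * m2 A)%E.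
Proof.
move=> inv1 inv2 mA mB.
(* Tonelli: sections may be measured along either factor, which lets the shears alternate. *)
have m12E X : measurable X -> (m1 \x m2)%E X = (m1 \x^ m2)%E X.
  by apply: product_measure_unique => C D mC mD; exact: product_measure2E.
have mN (f : 'rV[R]_n * 'rV[R]_n -> 'rV[R]_n) :
    measurable_fun setT f -> measurable_fun setT (fun x => - f x).
  move=> mf; apply: measurable_fun_rV => i; under eq_fun do rewrite mxE.
  by apply: measurable_funN; exact: measurable_coord.
pose S := [set z : 'rV[R]_n * 'rV[R]_n | A (z.1 + z.2) /\ B z.2].
pose S' := [set z : 'rV[R]_n * 'rV[R]_n | A z.2 /\ B (z.2 - z.1)].
have mNB : measurable ((-%R : 'rV[R]_n -> 'rV[R]_n) @^-1` B).
  rewrite -[X in measurable X]setTI; apply: (measurable_fun_rV _) => // i.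
  under eq_fun do rewrite mxE.
  by apply: measurable_funN; exact: measurable_rV_coord.
have mS : measurable S.
  apply: measurableI; rewrite -[X in measurable X]setTI.
    by apply: (measurable_rVD _ _) => //; exact: measurable_snd.
  exact: measurable_snd.
have mS' : measurable S'.
  apply: measurableI; rewrite -[X in measurable X]setTI.
    exact: measurable_snd.
  by apply: (measurable_rVD _ _) => //; apply: mN.
transitivity ((m1 \x m2)%E S).
  rewrite m12E// -(product_measure2E m1 m2 mA mB).
  apply: eq_integral => y _ /=.
  rewrite -(inv1 y (ysection (A `*` B) y)); last first.
    by apply: measurable_ysection; exact: measurableX.
  by congr (m1 _); apply/seteqP; split=> x; rewrite /ysection/= !inE.
transitivity ((m1 \x m2)%E S').
  apply: eq_integral => x _ /=.
  have mS'x : measurable (xsection S' x) by exact: measurable_xsection.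
  rewrite -(inv2 x _ mS'x).
  by congr (m2 _); apply/seteqP; split=> y;
    rewrite /xsection/= !inE /S /S'/= addrK [y + x]addrC.
rewrite m12E// -(product_measure2E m1 m2 mNB mA).
apply: eq_integral => z _ /=.
have mz : measurable (ysection ((-%R @^-1` B) `*` A) z).
  by apply: measurable_ysection; exact: measurableX.
rewrite -(inv1 (- z) _ mz).
by congr (m1 _); apply/seteqP; split=> x;
  rewrite /ysection/= !inE /S'/= opprB; tauto.
Qed.

End lebesgue_rV_invariance.

(** * Invariance of Lebesgue measure under orthogonal matrices *)

Section orthogonal_matrices.
Context {R : realType} {n : nat}.
Implicit Types (x y : 'rV[R]_n) (M : 'M[R]_n) (A : set 'rV[R]_n).

Lemma measurable_rV_box (A : 'I_n -> set R) : (forall i, measurable (A i)) ->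
  measurable [set x : 'rV[R]_n | forall i, A i (x ord0 i)].
Proof.
move=> mA; rewrite (_ : mkset _ = \bigcap_(i in [set: 'I_n])
    ((fun x : 'rV[R]_n => x ord0 i) @^-1` A i)).
  apply: fin_bigcap_measurable => // i _.
  by rewrite -[X in measurable X]setTI; apply: measurable_rV_coord.
by apply/seteqP; split=> x h i; [move=> _; exact: h|exact: (h i I)].
Qed.

Lemma dotvE x y : dotv x y = (x *m y^T) ord0 ord0.
Proof. by rewrite mxE; apply: eq_bigr => i _; rewrite mxE. Qed.

Lemma dotv_mulmx M x y : M *m M^T = 1%:M -> dotv (x *m M) (y *m M) = dotv x y.
Proof. by move=> MM; rewrite !dotvE trmx_mul mulmxA -(mulmxA x) MM mulmx1. Qed.

Lemma measurable_dotv : measurable_fun setT (fun x : 'rV[R]_n => dotv x x).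
Proof.
apply: measurable_sum => i.
by apply: measurable_funM; exact: measurable_rV_coord.
Qed.

Lemma mulmx_preimageK M A : M *m M^T = 1%:M ->
  (fun x => x *m M) @^-1` ((fun x => x *m M^T) @^-1` A) = A.
Proof.
by move=> MM; rewrite -comp_preimage; apply/seteqP; split=> x /=;
  rewrite -mulmxA MM mulmx1.
Qed.

Lemma measurable_mulmx_preimage M A : measurable A ->
  measurable ((fun x => x *m M) @^-1` A).
Proof.
by move=> mA; rewrite -[X in measurable X]setTI; exact: measurable_mulmx.
Qed.

Section rotated_lebesgue.
Context (M : 'M[R]_n) (MM : M *m M^T = 1%:M).

Local Notation mu := (lebesgue_rV R n).

(** Named so that it can carry the measure and sigma-finiteness structures that
    [product_translation_invariant] asks for. *)
Definition rotated_lebesgue : set 'rV[R]_n -> \bar R :=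
  pushforward mu (fun x => x *m M).

(* Side condition of the library's measure instance on [pushforward]. *)
Let mM := measurable_mulmx n n M.

Let rotated0 : rotated_lebesgue set0 = 0%E.
Proof. exact: measure0. Qed.

Let rotated_ge0 A : (0 <= rotated_lebesgue A)%E.
Proof. exact: measure_ge0. Qed.

Let rotated_sigma_additive : semi_sigma_additive rotated_lebesgue.
Proof. exact: measure_semi_sigma_additive. Qed.

HB.instance Definition _ := isMeasure.Build _ _ _ rotated_lebesgue
  rotated0 rotated_ge0 rotated_sigma_additive.

Let rotated_sigma_finite : sigma_finite setT rotated_lebesgue.
Proof.
have /sigma_finiteP[F [TF _ Foo]] := sigma_finiteT mu.
exists (fun k => (fun x => x *m M^T) @^-1` F k).
  by rewrite -preimage_bigcup -TF.
move=> k; have [mF Fk] := Foo k; split; first exact: measurable_mulmx_preimage.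
by rewrite /rotated_lebesgue /pushforward mulmx_preimageK.
Qed.

HB.instance Definition _ := Measure_isSigmaFinite.Build _ _ _ rotated_lebesgue
  rotated_sigma_finite.

(** As [M^T] inverts [M], a shift by [b] after the rotation is a shift by [b *m M^T] before it. *)
Let rotated_translation : translation_invariant rotated_lebesgue.
Proof.
move=> b A mA; rewrite -[RHS](lebesgue_rV_translation _ (b *m M^T)).
  congr (mu _); apply/seteqP.
  by split=> x /=; rewrite mulmxDl -mulmxA (mulmx1C MM) mulmx1.
exact: measurable_mulmx_preimage.
Qed.

(* Both measures are translation invariant, hence proportional; they agree on
   a centred Euclidean ball, which fixes the factor to be [1]. *)
Lemma lebesgue_rV_orthogonal A : measurable A ->
  mu ((fun x => x *m M) @^-1` A) = mu A.
Proof.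
(* With squared radius [n%:R] the ball contains [box 1], so its measure is positive, and lies in
   [box n.+1%:R], so it is finite. The half-side [n.+1] is positive even for [n = 0]. *)
move=> mA; pose B := [set x : 'rV[R]_n | dotv x x <= n%:R].
have mB : measurable B.
  rewrite (_ : B = (fun x => dotv x x) @^-1` `]-oo, n%:R]).
    by rewrite -[X in measurable X]setTI; apply: measurable_dotv.
  by apply/seteqP; split=> x; rewrite /B/= in_itv.
pose box (c : R) := [set x : 'rV[R]_n | forall i, `[- c, c]%classic (x ord0 i)].
have mbox c : measurable (box c).
  exact: (measurable_rV_box (fun=> `[- c, c]%classic)).
have mubox c : 0 < c -> mu (box c) = (\prod_(i < n) (c - - c))%:E.
  move=> c0; rewrite (@lebesgue_rV_box R n (fun=> `[- c, c]%classic))//.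
  rewrite -prodEFin; apply: eq_bigr => i _.
  by rewrite lebesgue_measure_itv/= lte_fin gtrN//.
have muB_fin : mu B \is a fin_num.
  rewrite ge0_fin_numE// (@le_lt_trans _ _ (mu (box n.+1%:R)))//; last first.
    by rewrite mubox// ltry.
  apply: le_measure; rewrite ?inE// => x Bx i /=.
  rewrite in_itv/= -ler_norml -ler_sqr ?nnegrE// real_normK ?num_real//.
  apply: (@le_trans _ _ n%:R); last first.
    by rewrite -natrX ler_nat expnS (leq_trans (leqnSn n))// leq_pmulr.
  apply: le_trans Bx; rewrite /dotv (bigD1 i)//= -expr2 lerDl.
  by apply: sumr_ge0 => j _; rewrite -expr2 sqr_ge0.
have muB_gt0 : (0 < mu B)%E.
  apply: (@lt_le_trans _ _ (mu (box 1))).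
    by rewrite mubox// lte_fin prodr_gt0// => i _; rewrite opprK.
  apply: le_measure; rewrite ?inE// => x xbox; rewrite /B/= /dotv.
  rewrite -[leRHS]mulr1 -[n in n%:R]card_ord mulr_natl -sumr_const.
  apply: ler_sum => i _; rewrite -expr2 -real_normK ?num_real//.
  by rewrite expr_le1//; have := xbox i; rewrite /= in_itv/= -ler_norml.
have nuB : rotated_lebesgue B = mu B.
  rewrite /rotated_lebesgue /pushforward; congr (mu _).
  by apply/seteqP; split=> x; rewrite /B/= dotv_mulmx.
have NB : -%R @^-1` B = B.
  by apply/seteqP; split=> x; rewrite /B/= !dotvE linearN/= mulNmx mulmxN opprK.
(* The ball is invariant under both negation and the rotation, so the exchange identity has the
   factor [mu B] on both sides. *)
have E : (mu A * mu B = mu ((fun x => x *m M) @^-1` A) * mu B)%E.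
  have P := product_translation_invariant n mu rotated_lebesgue A B
    (lebesgue_rV_translation n) rotated_translation mA mB.
  rewrite NB in P; rewrite -{1}nuB [RHS]muleC; exact: P.
apply: le_anti; rewrite -(lee_pmul2r muB_fin muB_gt0) E lexx/=.
by rewrite -(lee_pmul2r muB_fin muB_gt0) E.
Qed.

End rotated_lebesgue.
End orthogonal_matrices.

(** * Open sets and continuous functions are measurable *)

Section borel_rV.
Context {R : realType} {n : nat}.

(** The sigma-algebra is generated by coordinates, so the open set is written as the countable union
    of the boxes with rational corners that it contains. *)
Lemma open_measurable_rV (U : set 'rV[R]_n) : open U -> measurable U.
Proof.
move=> oU.
pose box (q : {ffun 'I_n -> rat * rat}) :=
  [set x : 'rV[R]_n | forall i, `]ratr (q i).1, ratr (q i).2[%classic (x ord0 i)].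
pose F q := if `[< box q `<=` U >] then box q else set0.
have -> : U = \bigcup_q F q.
  apply/seteqP; split=> [x Ux|x [q _]]; last first.
    by rewrite /F; case: asboolP => // /[apply].
  have [P Px PU] : nbhs x U by exact: open_nbhs_nbhs.
  have /choice[q qP] : forall i, exists q : rat * rat,
      [/\ ratr q.1 < x ord0 i, x ord0 i < ratr q.2 &
      `]ratr q.1, ratr q.2[ `<=` P ord0 i].
    move=> i; have /nbhs_ballP[e /= e0 eP] := Px ord0 i.
    have [a /[!in_itv]/= /andP[xa ax]] : exists a : rat,
        ratr a \in `](x ord0 i - e), (x ord0 i)[.
      by apply: rat_in_itvoo; rewrite ltrBlDr ltrDl.
    have [b /[!in_itv]/= /andP[xb bx]] : exists b : rat,
        ratr b \in `](x ord0 i), (x ord0 i + e)[.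
      by apply: rat_in_itvoo; rewrite ltrDl.
    exists (a, b); split => //= y /=; rewrite in_itv/= => /andP[ay yb].
    by apply: eP; rewrite /ball/= ltr_distlC; apply/andP; split; lra.
  exists [ffun i => q i] => //; rewrite /F; case: asboolP => [_ i|].
    by rewrite ffunE /= in_itv/=; have [-> ->] := qP i.
  case=> y yq; apply: PU => i j; rewrite ord1.
  by have [_ _] := qP j; apply; have := yq j; rewrite ffunE.
apply: countable_bigcupT_measurable => [|q]; first exact: countableP.
rewrite /F; case: ifP => // _.
exact: (measurable_rV_box (fun i => `]ratr (q i).1, ratr (q i).2[%classic)).
Qed.

Lemma closed_measurable_rV (A : set 'rV[R]_n) : closed A -> measurable A.
Proof.
move=> cA; rewrite -[A]setCK; apply: measurableC; apply: open_measurable_rV.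
exact: closed_openC.
Qed.

Lemma compact_measurable_rV (A : set 'rV[R]_n) : compact A -> measurable A.
Proof.
by move=> cA; apply: closed_measurable_rV; exact: compact_closed.
Qed.

Lemma continuous_measurable_rV (f : 'rV[R]_n -> R) :
  continuous f -> measurable_fun setT f.
Proof.
move=> cf; apply: (measurability _ (RGenOpens.measurableE R)).
move=> _ [_ [a [b ->]] <-]; rewrite setTI; apply: open_measurable_rV.
by move/continuousP : cf; apply; exact: interval_open.
Qed.

Lemma continuous_rV (T : topologicalType) (f : T -> 'rV[R]_n) :
  (forall i, continuous (fun x => f x ord0 i)) -> continuous f.
Proof.
move=> cf x A [P Px PA].
have : \near x, forall i, P ord0 i (f x ord0 i).
  by apply: filter_forall => i; exact: cf.
by apply: filterS => y Py; apply: PA => i j; rewrite ord1.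
Qed.

End borel_rV.

(** * Rigid motions and change of variables *)

Section motion.
Context {R : realType} {n : nat}.
Implicit Types (x y b : 'rV[R]_n) (M : 'M[R]_n) (A : set 'rV[R]_n).

Local Notation mu := (lebesgue_rV R n).

(** A rotation about [x0] has this form with [b = x0 - x0 *m M]. For orthogonal [M] the inverse has
    it too, so each pullback result also applies to the inverse. *)
Definition motion M b x := x *m M + b.

Lemma motionK M b : M *m M^T = 1%:M ->
  cancel (motion M b) (motion M^T (- (b *m M^T))).
Proof. by move=> MM x; rewrite /motion mulmxDl -mulmxA MM mulmx1 addrK. Qed.

Lemma motionVK M b : M *m M^T = 1%:M ->
  cancel (motion M^T (- (b *m M^T))) (motion M b).
Proof.
move=> MM x; rewrite /motion mulmxDl mulNmx -!mulmxA (mulmx1C MM) !mulmx1.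
exact: subrK.
Qed.

Lemma differentiable_motion M b x : differentiable (motion M b) x.
Proof.
have cM : continuous (mulmxr M : 'rV[R]_n -> 'rV[R]_n).
  apply: continuous_rV => j y; apply: differentiable_continuous.
  rewrite (_ : (fun _ => _) = \sum_(i < n) (fun x : 'rV[R]_n => x ord0 i * M i j)).
    by apply: differentiable_sum => i; apply: differentiableM => //;
      exact: differentiable_coord.
  by apply/funext => z; rewrite /= mxE fct_sumE.
apply: differentiableD => //.
exact: (linear_differentiable _ cM).
Qed.

Lemma continuous_motion M b : continuous (motion M b).
Proof. by move=> x; exact/differentiable_continuous/differentiable_motion. Qed.

Lemma measurable_motion M b : measurable_fun setT (motion M b).
Proof. exact: (measurable_rVD _ _ _ _ _ (measurable_mulmx _ _ _) _). Qed.

Lemma lebesgue_rV_motion M b A : M *m M^T = 1%:M -> measurable A ->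
  mu (motion M b @^-1` A) = mu A.
Proof.
move=> MM mA; rewrite -[RHS](lebesgue_rV_translation n b)//.
rewrite -[RHS](lebesgue_rV_orthogonal M MM)//.
rewrite -[X in measurable X]setTI.
exact: (measurable_rVD _ _ _ _ _ _ _).
Qed.

(** The image of [mu] under the motion is [mu], so the pushforward formula is a change of variables
    with no Jacobian factor. *)
Lemma ge0_integral_motion M b (D : set 'rV[R]_n) (f : 'rV[R]_n -> \bar R) :
  M *m M^T = 1%:M -> measurable D -> measurable_fun D f ->
  (forall x, D x -> 0 <= f x)%E ->
  (\int[mu]_(x in motion M b @^-1` D) f (motion M b x) = \int[mu]_(x in D) f x)%E.
Proof.
move=> MM mD mf f0.
rewrite -(@ge0_integral_pushforward _ _ _ _ _ _ (measurable_motion M b) mu D f)//.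
  apply: eq_measure_integral => [|mf' A mA _]; first exact: measurable_motion.
  exact: lebesgue_rV_motion.
by move=> y /[!inE]; exact: f0.
Qed.

Lemma integral_motion M b (f : 'rV[R]_n -> \bar R) :
  M *m M^T = 1%:M -> measurable_fun setT f ->
  (\int[mu]_x f (motion M b x) = \int[mu]_x f x)%E.
Proof.
move=> MM mf; rewrite integralE [RHS]integralE.
have P (g : 'rV[R]_n -> \bar R) : measurable_fun setT g ->
    (forall x, 0 <= g x)%E -> (\int[mu]_x g (motion M b x) = \int[mu]_x g x)%E.
  by move=> mg g0; rewrite -[RHS](ge0_integral_motion M b setT).
congr (_ - _)%E.
  rewrite -(P _ (measurable_funepos mf) (funepos_ge0 f)).
  by apply: eq_integral => x _; rewrite !funeposE.
rewrite -(P _ (measurable_funeneg mf) (funeneg_ge0 f)).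
by apply: eq_integral => x _; rewrite !funenegE.
Qed.

Lemma Rintegral_motion M b (f : 'rV[R]_n -> R) :
  M *m M^T = 1%:M -> measurable_fun setT f ->
  \int[mu]_x f (motion M b x) = \int[mu]_x f x.
Proof.
move=> MM mf; rewrite /Rintegral (integral_motion M b (EFin \o f))//.
exact/measurable_EFinP.
Qed.

Lemma integrable_motion M b (D : set 'rV[R]_n) (f : 'rV[R]_n -> \bar R) :
  M *m M^T = 1%:M -> measurable D -> measurable_fun setT f ->
  mu.-integrable D f -> mu.-integrable (motion M b @^-1` D) (f \o motion M b).
Proof.
move=> MM mD mf /integrableP[_ fD]; apply/integrableP; split.
  apply: measurable_funTS; apply: measurableT_comp => //.
  exact: measurable_motion.
have E : (\int[mu]_(x in motion M b @^-1` D) `|f (motion M b x)| =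
    \int[mu]_(x in D) `|f x|)%E.
  apply: (ge0_integral_motion M b D (abse \o f)) => // [|x _ /=]; last first.
    exact: abse_ge0.
  by apply: measurableT_comp => //; exact: measurable_funTS.
by move: fD; rewrite -E.
Qed.

Lemma loc_integrable_motion M b (f : 'rV[R]_n -> R) : M *m M^T = 1%:M ->
  loc_integrable f -> loc_integrable (f \o motion M b).
Proof.
move=> MM [mf lf]; split.
  by apply: measurableT_comp => //; exact: measurable_motion.
move=> K cK; pose g := motion M^T (- (b *m M^T)).
(* [K] is the preimage of its own image under the motion, and that image is compact by
   continuity. *)
have KE : K = motion M b @^-1` (g @^-1` K).
  by apply/seteqP; split => x; rewrite /= /g motionK.
have cgK : compact (g @^-1` K).
  have -> : g @^-1` K = motion M b @` K.
    apply/seteqP; split=> x /=; first by exists (g x) => //; exact: motionVK.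
    by move=> [y Ky <-]; rewrite /g motionK.
  apply: continuous_compact => //; apply: continuous_subspaceT.
  exact: continuous_motion.
rewrite {1}KE; apply: (integrable_motion M b (g @^-1` K) (EFin \o f)) => //.
- exact: compact_measurable_rV.
- exact/measurable_EFinP.
- exact: lf.
Qed.

End motion.

(** * Smooth functions and test functions under motions *)

Section test_functions.
Context {R : realType} {n : nat}.
Implicit Types (f g phi u : 'rV[R]_n -> R) (M : 'M[R]_n) (b : 'rV[R]_n).

Local Notation mu := (lebesgue_rV R n).

(** Chain rule: the motion carries the basis direction [i] to row [i] of [M], and the differential
    is linear in the direction. *)
Lemma partial_motion M b f i x : differentiable f (motion M b x) ->
  partial i (f \o motion M b) x = \sum_(j < n) M i j * partial j f (motion M b x).
Proof.
move=> df; rewrite /partial.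
have -> : 'D_(delta_mx ord0 i) (f \o motion M b) x =
    'D_(delta_mx ord0 i *m M) f (motion M b x).
  have E (h : R) : motion M b (h *: delta_mx ord0 i + x) =
      h *: (delta_mx ord0 i *m M) + motion M b x.
    by rewrite /motion mulmxDl -scalemxAl addrA.
  by rewrite /derive /=; under eq_fun do rewrite E.
rewrite deriveE//.
have -> : delta_mx ord0 i *m M = \sum_(j < n) M i j *: (delta_mx ord0 j : 'rV[R]_n).
  by rewrite -rowE [LHS]row_sum_delta; apply: eq_bigr => j _; rewrite mxE.
rewrite linear_sum; apply: eq_bigr => j _.
by rewrite linearZ/= deriveE.
Qed.

(** The invariant for iterating [partial] on [f \o motion M b]: a class of linear combinations of
    moved derivatives of [f], stable under every [partial i] and made of differentiable functions
    when [f] is smooth. *)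
Inductive pulled_back M b f : ('rV[R]_n -> R) -> Prop :=
| Pulled_back0 : pulled_back M b f (fun=> 0)
| Pulled_backD c s g : pulled_back M b f g ->
    pulled_back M b f (fun x => c * foldr (@partial R n) f s (motion M b x) + g x).

Lemma pulled_back_add M b f g h : pulled_back M b f g -> pulled_back M b f h ->
  pulled_back M b f (fun x => g x + h x).
Proof.
move=> pg ph; elim: pg => [|c s g' _ IH].
  by under eq_fun do rewrite add0r.
by under eq_fun do rewrite -addrA; exact: Pulled_backD.
Qed.

Lemma differentiable_pulled_back M b f g x : smooth f -> pulled_back M b f g ->
  differentiable g x.
Proof.
move=> sf; elim=> [|c s h _ dh]; first exact: differentiable_cst.
apply: differentiableD => //; apply: differentiableM; first exact: differentiable_cst.
by apply: differentiable_comp; [exact: differentiable_motion|exact: sf].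
Qed.

Lemma partial_pulled_back M b f g i : smooth f -> pulled_back M b f g ->
  pulled_back M b f (partial i g).
Proof.
move=> sf; elim=> [|c s h ph IH].
  rewrite (_ : partial i _ = fun=> 0); first exact: Pulled_back0.
  by apply/funext => x; rewrite /partial derive_cst.
(* Each term splits into one term per column [j], with [j] put in front of the list of
   derivatives. *)
have -> : partial i (fun x => c * foldr (@partial R n) f s (motion M b x) + h x) =
    (fun x => \sum_(j < n) (c * M i j) * foldr (@partial R n) f (j :: s) (motion M b x)
      + partial i h x).
  apply/funext => x; pose F := foldr (@partial R n) f s \o motion M b.
  have dF : differentiable F x.
    by apply: differentiable_comp; [exact: differentiable_motion|exact: sf].
  have dh : differentiable h x by exact: differentiable_pulled_back sf ph.
  rewrite /partial deriveD; last 2 first.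
  - by apply: diff_derivable; apply: differentiableM => //; exact: differentiable_cst.
  - exact: diff_derivable.
  congr (_ + _); rewrite (@deriveMl _ _ F c)//; last exact: diff_derivable.
  have := partial_motion M b (foldr (@partial R n) f s) i x (sf s _).
  rewrite /partial => ->.
  by rewrite mulr_sumr; apply: eq_bigr => j _; rewrite mulrA.
apply: pulled_back_add => //.
elim: (index_enum _) => [|j l IHl].
  by under eq_fun do rewrite big_nil; exact: Pulled_back0.
by under eq_fun do rewrite big_cons; exact: Pulled_backD.
Qed.

Lemma smooth_motion M b f : smooth f -> smooth (f \o motion M b).
Proof.
move=> sf s x; apply: (differentiable_pulled_back M b f _ x sf).
elim: s {x} => [|i s IH]; last exact: partial_pulled_back.
(* The base case is the one-term combination with coefficient [1] and no derivative. *)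
have := Pulled_backD M b f 1 [::] (fun=> 0) (Pulled_back0 M b f).
by under eq_fun do rewrite mul1r addr0.
Qed.

Lemma test_function_motion M b phi : M *m M^T = 1%:M ->
  test_function phi -> test_function (phi \o motion M b).
Proof.
move=> MM [sphi cphi]; split; first exact: smooth_motion.
set K := closure [set x | phi x != 0] in cphi.
pose T' := motion M^T (- (b *m M^T)).
have cT'K : compact (T' @` K).
  apply: continuous_compact => //; apply: continuous_subspaceT.
  exact: continuous_motion.
(* The support of the composite lies in the image of [K] under the inverse motion. *)
apply: (subclosed_compact _ cT'K); first exact: closed_closure.
have cl : closed (T' @` K) by exact: compact_closed.
rewrite [X in _ `<=` X](closure_id _).1//; apply: closure_subset => x /= phix.
exists (motion M b x); last exact: motionK.
exact: subset_closure.
Qed.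

Lemma smooth_partial f i : smooth f -> smooth (partial i f).
Proof. by move=> sf s x; have := sf (rcons s i) x; rewrite foldr_rcons. Qed.

Lemma smooth_continuous f : smooth f -> continuous f.
Proof. by move=> sf x; apply: differentiable_continuous; exact: (sf [::] x). Qed.

Lemma test_function_partial phi i : test_function phi -> test_function (partial i phi).
Proof.
move=> [sphi cphi]; split; first exact: smooth_partial.
apply: (subclosed_compact _ cphi); first exact: closed_closure.
set K := closure [set x | phi x != 0].
have cK : closed K by exact: closed_closure.
rewrite [X in _ `<=` X](closure_id _).1//; apply: closure_subset => x /= dphi.
apply: contrapT => Kx; move/negP: dphi; apply; apply/eqP.
(* Off the closed set [K] the function vanishes on a whole neighbourhood, hence so does its
   derivative at [x]. *)
have : \forall y \near x, phi y = 0.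
  have : nbhs x (~` K) by apply: open_nbhs_nbhs; split; [exact: closed_openC|exact: Kx].
  apply: filterS => y Ky; apply/eqP/negPn/negP => phiy; apply: Ky.
  exact: subset_closure.
move=> phi0; rewrite /partial.
rewrite (near_eq_derive (g := cst 0)) ?derive_cst//.
Qed.

(** The test function is bounded and vanishes off a compact [K], so the product is dominated by a
    multiple of [f] restricted to [K]. *)
Lemma test_function_integrable f phi : loc_integrable f -> test_function phi ->
  mu.-integrable setT (fun x => (f x * phi x)%:E).
Proof.
move=> [mf lf] [/smooth_continuous cphi]; set K := closure _ => cK.
have mK : measurable K by exact: compact_measurable_rV.
have mphi : measurable_fun setT phi by exact: continuous_measurable_rV.
have [C phiC] : exists C, forall x, `|phi x| <= C.
  have : compact (phi @` K).
    by apply: continuous_compact => //; exact: continuous_subspaceT.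
  move=> /compact_bounded[C [_ CK]]; exists (`|C| + 1) => x.
  have [Kx|Kx] := pselect (K x).
    apply: (CK (`|C| + 1)); last by exists x.
    by rewrite (le_lt_trans (ler_norm _))// ltrDl.
  suff -> : phi x = 0 by rewrite normr0 addr_ge0.
  by apply/eqP/negPn/negP => phix; apply: Kx; exact: subset_closure.
have /(integrable_mkcond _ mK) fK := lf K cK.
have mfphi : measurable_fun setT (fun x => (f x * phi x)%:E).
  by apply/measurable_EFinP; exact: measurable_funM.
apply: (le_integrable measurableT mfphi _ (integrableZl measurableT C fK)).
move=> x _; rewrite patchE; case: ifPn => Kx.
  rewrite /= lee_fin !normrM [leRHS]mulrC ler_wpM2l//.
  by rewrite (le_trans (phiC x))// ler_norm.
rewrite (_ : phi x = 0) ?mulr0 ?abse0//.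
apply/eqP/negPn/negP => phix; move/negP: Kx; apply; rewrite inE.
exact: subset_closure.
Qed.

End test_functions.

(** * The space of functions with weak gradients, under motions and combinations *)

Section sobolev.
Context {R : realType} {n : nat} (p : R) (p1 : 1 <= p).
Implicit Types (f g phi u v : 'rV[R]_n -> R) (G H : 'rV[R]_n -> 'rV[R]_n).
Implicit Types (M : 'M[R]_n) (b : 'rV[R]_n).

Local Notation mu := (lebesgue_rV R n).

(** Sums over an arbitrary list serve twice: over coordinates, to rotate a gradient, and over
    booleans, to combine two functions. *)
Lemma loc_integrable_sum I (s : seq I) (c : I -> R) (h : I -> 'rV[R]_n -> R) :
  (forall i, loc_integrable (h i)) ->
  loc_integrable (fun x => \sum_(i <- s) c i * h i x).
Proof.
move=> lh; split.
  apply: measurable_sum => i; apply: measurable_funM => //.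
  by have [] := lh i.
move=> K cK; have mK := compact_measurable_rV K cK.
rewrite (_ : _ \o _ = (fun x => \sum_(i <- s) ((c i)%:E * (h i x)%:E))%E).
  apply: integrable_sum => // i _; apply: integrableZl => //.
  by have [_] := lh i; apply.
by apply/funext => x /=; rewrite -sumEFin; apply: eq_bigr => i _; rewrite EFinM.
Qed.

Lemma Rintegral_sum I (s : seq I) (c : I -> R) (h : I -> 'rV[R]_n -> R) :
  (forall i, mu.-integrable setT (EFin \o h i)) ->
  \int[mu]_x (\sum_(i <- s) c i * h i x) = \sum_(i <- s) c i * \int[mu]_x h i x.
Proof.
move=> ih; elim: s => [|i s IH].
  under eq_Rintegral do rewrite big_nil.
  by rewrite Rintegral_cst// mul0r big_nil.
rewrite big_cons -IH -RintegralZl//.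
rewrite -RintegralD//; last 2 first.
- exact: (integrableZl _ _ (ih i)).
- rewrite (_ : _ \o _ = (fun x => \sum_(i <- s) ((c i)%:E * (h i x)%:E))%E).
    by apply: integrable_sum => // k _; exact: (integrableZl _ _ (ih k)).
  by apply/funext => x /=; rewrite -sumEFin; apply: eq_bigr => k _; rewrite EFinM.
by apply: eq_Rintegral => x _; rewrite big_cons.
Qed.

Lemma Rintegral_test_sum I (s : seq I) (c : I -> R) (h : I -> 'rV[R]_n -> R) phi :
  (forall i, loc_integrable (h i)) -> test_function phi ->
  \int[mu]_x ((\sum_(i <- s) c i * h i x) * phi x) =
  \sum_(i <- s) c i * \int[mu]_x (h i x * phi x).
Proof.
move=> lh tphi; rewrite -Rintegral_sum => [|i]; last exact: test_function_integrable.
by apply: eq_Rintegral => x _; rewrite mulr_suml; apply: eq_bigr => i _; rewrite mulrA.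
Qed.

Lemma weak_partial_sum I (s : seq I) (c : I -> R) (h k : I -> 'rV[R]_n -> R) j :
  (forall i, weak_partial j (h i) (k i)) ->
  weak_partial j (fun x => \sum_(i <- s) c i * h i x)
                 (fun x => \sum_(i <- s) c i * k i x).
Proof.
move=> hk; have lh i : loc_integrable (h i) by have [] := hk i.
have lk i : loc_integrable (k i) by have [] := hk i.
split; [exact: loc_integrable_sum|exact: loc_integrable_sum|move=> phi tphi].
rewrite !Rintegral_test_sum//; last exact: test_function_partial.
rewrite -sumrN; apply: eq_bigr => i _; have [_ _ ->//] := hk i.
by rewrite mulrN.
Qed.

(** A change of variables moves the motion onto the test function, where the classical chain rule
    applies; the weak identity for [u] is then used in each direction [j]. *)
Lemma weak_gradient_motion M b u G : M *m M^T = 1%:M ->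
  weak_gradient u G ->
  weak_gradient (u \o motion M b) (fun x => G (motion M b x) *m M^T).
Proof.
move=> MM uG i.
have GE x : (G (motion M b x) *m M^T) ord0 i =
    \sum_(j <- index_enum 'I_n) M i j * G (motion M b x) ord0 j.
  by rewrite mxE; apply: eq_bigr => j _; rewrite mxE mulrC.
have lu : loc_integrable u by have [] := uG i.
have lG j : loc_integrable (fun x => G x ord0 j) by have [] := uG j.
under eq_fun do rewrite GE.
split; first exact: loc_integrable_motion.
  apply: (loc_integrable_sum _ _ _ (fun j => (fun x => G x ord0 j) \o motion M b)).
  by move=> j; exact: loc_integrable_motion.
(* [psi] is [phi] read in the moved variable, so that [u] can be tested against it directly. *)
move=> phi tphi; pose psi := phi \o motion M^T (- (b *m M^T)).
have tpsi : test_function psi.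
  by apply: test_function_motion => //; rewrite trmxK; exact: mulmx1C.
have phiE : phi = psi \o motion M b.
  by apply/funext => x; rewrite /psi/= motionK.
have mf f g : loc_integrable f -> test_function g ->
    measurable_fun setT (fun x => f x * g x).
  move=> [mf _] [/smooth_continuous cg _]; apply: measurable_funM => //.
  exact: continuous_measurable_rV.
pose D x := \sum_(j <- index_enum 'I_n) M i j * partial j psi x.
have mD : measurable_fun setT (fun x => u x * D x).
  apply: measurable_funM; first by have [] := lu.
  apply: measurable_sum => j; apply: measurable_funM => //.
  apply: continuous_measurable_rV; apply: smooth_continuous.
  by have [] := test_function_partial psi j tpsi.
transitivity (\int[mu]_x (u x * D x)).
  rewrite -(Rintegral_motion M b _ MM mD); apply: eq_Rintegral => x _.
  rewrite phiE partial_motion//.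
  by have [spsi _] := tpsi; exact: (spsi [::]).
transitivity (- \sum_(j <- index_enum 'I_n) M i j * \int[mu]_x (G x ord0 j * psi x)).
  transitivity (\sum_(j <- index_enum 'I_n) M i j * \int[mu]_x (u x * partial j psi x)).
    rewrite -Rintegral_sum => [|j]; last first.
      by apply: test_function_integrable => //; exact: test_function_partial.
    apply: eq_Rintegral => x _; rewrite mulr_sumr; apply: eq_bigr => j _.
    by rewrite mulrCA.
  rewrite -sumrN; apply: eq_bigr => j _.
  by have [_ _ ->//] := uG j; rewrite mulrN.
congr (- _); rewrite -Rintegral_test_sum//.
rewrite -(Rintegral_motion M b _ MM).
  by apply: eq_Rintegral => x _; rewrite phiE.
by apply: mf => //; exact: loc_integrable_sum.
Qed.

Lemma Lfun_sum I (s : seq I) (c : I -> R) (h : I -> 'rV[R]_n -> R) :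
  (forall i, h i \in Lfun mu p%:E) ->
  (fun x => \sum_(i <- s) c i * h i x) \in Lfun mu p%:E.
Proof.
move=> lh; have [l0 lD] := Lfun_addr_closed mu (p1 : (1 <= p%:E)%E).
elim: s => [|i s IH].
  by under eq_fun do rewrite big_nil; exact: l0.
under eq_fun do rewrite big_cons [c i * _]mulrC.
by apply: lD => //; exact: Lfun_scale.
Qed.

Lemma Lfun_motion M b f : M *m M^T = 1%:M ->
  f \in Lfun mu p%:E -> f \o motion M b \in Lfun mu p%:E.
Proof.
move=> MM fL; have [mf fp] : measurable_fun setT f /\ finite_norm mu p%:E f.
  by move: fL; rewrite inE => /andP[]; rewrite !inE.
rewrite inE; apply/andP; split; rewrite inE/=.
  by apply: measurableT_comp => //; exact: measurable_motion.
move: fp; rewrite /finite_norm unlock /Lnorm.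
rewrite -(ge0_integral_motion M b setT (fun x => (`|(f x)%:E| `^ p)%E))//.
- apply: (@measurableT_comp _ _ _ _ _ _ (fun x => (x `^ p)%E)) => //=.
    exact: measurable_poweR.
  by apply/measurable_EFinP; exact: measurableT_comp.
- by move=> x _; exact: poweR_ge0.
Qed.

Lemma D1p_gradient_motion M b u G : M *m M^T = 1%:M -> D1p_gradient p u G ->
  D1p_gradient p (u \o motion M b) (fun x => G (motion M b x) *m M^T).
Proof.
move=> MM [cu lu uG Gp]; split.
- move=> x; apply: (continuous_comp (f := motion M b) (g := u)); last exact: cu.
  exact: continuous_motion.
- exact: loc_integrable_motion.
- exact: weak_gradient_motion.
- move=> i; rewrite (_ : (fun _ => _) = (fun x => \sum_(j <- index_enum 'I_n)
      M i j * ((fun x => G x ord0 j) \o motion M b) x)).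
    apply: (Lfun_sum _ _ _ (fun j => (fun x => G x ord0 j) \o motion M b)) => j.
    exact: Lfun_motion.
  by apply/funext => x; rewrite mxE; apply: eq_bigr => j _; rewrite mxE mulrC.
Qed.

Lemma D1p_gradient_lin (a b : R) u v G H : D1p_gradient p u G -> D1p_gradient p v H ->
  D1p_gradient p (fun x => a * u x + b * v x) (fun x => a *: G x + b *: H x).
Proof.
move=> [cu lu uG Gp] [cv lv vH Hp].
pose c (i : bool) := if i then a else b.
have sumE (h : bool -> 'rV[R]_n -> R) : (fun x => a * h true x + b * h false x) =
    (fun x => \sum_(i <- [:: true; false]) c i * h i x).
  by apply/funext => x; rewrite !big_cons big_nil addr0.
pose w (i : bool) := if i then u else v.
pose g (j : 'I_n) (i : bool) := fun x => (if i then G x else H x) ord0 j.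
have gE j : (fun x => (a *: G x + b *: H x) ord0 j) =
    (fun x => \sum_(i <- [:: true; false]) c i * g j i x).
  by rewrite -(sumE (g j)); apply/funext => x; rewrite !mxE.
split.
- have ck (k : R) h : continuous h -> continuous (fun x : 'rV[R]_n => k * h x).
    by move=> ch x; exact: (cvgM (cvg_cst k) (ch x)).
  by move=> x; exact: (cvgD (ck a u cu x) (ck b v cv x)).
- by rewrite (sumE w); apply: loc_integrable_sum; case.
- by move=> j; rewrite gE (sumE w); apply: weak_partial_sum; case; rewrite /w /g.
- by move=> j; rewrite gE; apply: Lfun_sum; case; rewrite /g.
Qed.

End sobolev.

(** * Strict convexity of real powers *)

Section strict_convexity.
Context {R : realType}.

Lemma ln_lt_subr1 (t : R) : 0 < t -> t != 1 -> ln t < t - 1.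
Proof.
move=> t0 t1; have lnt0 : ln t != 0 by rewrite ln_eq0.
by rewrite ltrBrDl -[ltRHS](lnK t0); exact: expR_gt1Dx.
Qed.

(** Weighted AM-GM: with [A = s^p], the number [s] is the geometric mean of [A] and [1] with weights
    [1/p] and [1 - 1/p], and it lies strictly below their arithmetic mean [m]. *)
Lemma powR_bernoulli_lt (p s : R) : 1 < p -> 0 <= s -> s != 1 ->
  1 + p * (s - 1) < s `^ p.
Proof.
move=> p1; have p0 : 0 < p by lra.
rewrite le_eqVlt => /predU1P[<- _|s0 s1].
  by rewrite powR0 ?gt_eqF//; lra.
set A := s `^ p; have A0 : 0 < A by exact: powR_gt0.
have A1 : A != 1.
  apply: contra s1 => /eqP A1.
  have <- : s `^ (p * p^-1) = s by rewrite mulfV ?lt0r_neq0// powRr1// ltW.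
  by rewrite powRrM -/A A1 powR1.
pose m := (A + p - 1) / p.
have m0 : 0 < m by rewrite divr_gt0//; lra.
have Am : A / m != 1.
  apply: contra A1 => /eqP Am.
  have Em : A = m by rewrite -[LHS](divfK (lt0r_neq0 m0)) Am mul1r.
  have E : A * p = A + p - 1 by rewrite {1}Em /m divfK ?lt0r_neq0.
  have : (p - 1) * (A - 1) = 0 by lra.
  by move/eqP; rewrite mulf_eq0 !subr_eq0 (gt_eqF p1).
have lnA : ln A < ln m + (A / m - 1).
  have := ln_lt_subr1 _ (divr_gt0 A0 m0) Am.
  by rewrite ln_div ?posrE// ltrBlDl.
have lnm : 0 <= ln m + (m^-1 - 1).
  have [m1|m1] := eqVneq m 1; first by rewrite m1 ln1; lra.
  have := ln_lt_subr1 (m^-1); rewrite invr_gt0 m0 invr_eq1 m1 => /(_ isT isT).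
  by rewrite lnV ?posrE//; lra.
have lns : p * ln s = ln A by rewrite ln_powR.
(* Adding [lnA] to [p - 1] times [lnm], the non-logarithmic terms cancel because
   [(A + p - 1) / m = p]. *)
have : p * ln s < p * ln m.
  have E : (A + p - 1) / m = p by rewrite /m invf_div mulrCA mulfV ?mulr1//; lra.
  have : ln A + (p - 1) * 0 < (ln m + (A / m - 1)) + (p - 1) * (ln m + (m^-1 - 1)).
    by rewrite ltr_leD// ler_wpM2l//; lra.
  rewrite lns; move: E; rewrite !mulrDl; lra.
rewrite ltr_pM2l// ltr_ln ?posrE// /m ltr_pdivlMr//; lra.
Qed.

(** Both ends lie strictly above the tangent line at the midpoint [m] (fact [T]); in the sum of the
    two tangent values the slopes cancel. *)
Lemma powR_midpoint_lt (p a b : R) : 1 < p -> 0 <= a -> 0 <= b -> a != b ->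
  ((a + b) / 2) `^ p < (a `^ p + b `^ p) / 2.
Proof.
move=> p1 a0 b0 ab; set m := (a + b) / 2.
have m0 : 0 < m by rewrite /m; move/eqP: ab => ab; lra.
have T t : 0 <= t -> t != m -> m `^ p * (1 + p * (t / m - 1)) < t `^ p.
  move=> t0 tm; rewrite -[in ltRHS](divfK (lt0r_neq0 m0) t).
  rewrite (powRM _ (divr_ge0 t0 (ltW m0)) (ltW m0)) mulrC.
  rewrite ltr_pM2r ?powR_gt0//.
  apply: powR_bernoulli_lt => //; first by rewrite divr_ge0// ltW.
  by apply: contra tm => /eqP tm; rewrite -[t](divfK (lt0r_neq0 m0)) tm mul1r.
have Ta : m `^ p * (1 + p * (a / m - 1)) < a `^ p.
  by apply: T => //; apply: contra ab => /eqP; rewrite /m => ?; apply/eqP; lra.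
have Tb : m `^ p * (1 + p * (b / m - 1)) < b `^ p.
  by apply: T => //; apply: contra ab => /eqP; rewrite /m => ?; apply/eqP; lra.
have ab2 : a / m + b / m = 2.
  by rewrite -mulrDl /m invf_div mulrCA divff ?mulr1// gt_eqF//; move: m0; rewrite /m; lra.
rewrite ltr_pdivlMr//; apply: le_lt_trans (ltrD Ta Tb).
rewrite -mulrDr ler_wpM2l ?powR_ge0//.
rewrite (_ : b / m = 2 - a / m); last by rewrite -ab2; ring.
by rewrite le_eqVlt; apply/orP; left; apply/eqP; ring.
Qed.

End strict_convexity.

(** * Euclidean norm: Cauchy-Schwarz and strict convexity *)

Section euclidean_norm.
Context {R : realType} {n : nat}.
Implicit Types x y : 'rV[R]_n.

Lemma dotvv_ge0 x : 0 <= dotv x x.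
Proof. by apply: sumr_ge0 => i _; rewrite -expr2 sqr_ge0. Qed.

Lemma enorm_ge0 x : 0 <= enorm x.
Proof. exact: sqrtr_ge0. Qed.

Lemma sqr_enorm x : enorm x ^+ 2 = dotv x x.
Proof. by rewrite sqr_sqrtr// dotvv_ge0. Qed.

Lemma enorm_eq0 x : enorm x = 0 -> x = 0.
Proof.
move=> x0; have /eqP : dotv x x = 0 by rewrite -sqr_enorm x0 expr0n.
rewrite psumr_eq0 => [/allP x0'|i _]; last by rewrite -expr2 sqr_ge0.
apply/rowP => i; rewrite mxE; have := x0' i (mem_index_enum i).
by rewrite mulf_eq0 orbb => /eqP.
Qed.

Lemma enorm_gt0 x : x != 0 -> 0 < enorm x.
Proof.
by move=> x0; rewrite lt0r enorm_ge0 andbT; apply: contra x0 => /eqP/enorm_eq0 ->.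
Qed.

Lemma enorm0 : enorm (0 : 'rV[R]_n) = 0.
Proof. by rewrite /enorm /dotv big1 ?sqrtr0// => i _; rewrite mxE mul0r. Qed.

Lemma dotv_lin (a b : R) x y :
  dotv (a *: x + b *: y) (a *: x + b *: y) =
  a ^+ 2 * dotv x x + 2 * a * b * dotv x y + b ^+ 2 * dotv y y.
Proof.
rewrite /dotv !mulr_sumr -!big_split/=; apply: eq_bigr => i _.
by rewrite !mxE; ring.
Qed.

Lemma dotv_le_enorm x y : dotv x y <= enorm x * enorm y.
Proof.
have [x0|x0] := eqVneq (enorm x) 0.
  rewrite x0 mul0r (enorm_eq0 _ x0) /dotv big1// => i _.
  by rewrite mxE mul0r.
have [y0|y0] := eqVneq (enorm y) 0.
  rewrite y0 mulr0 (enorm_eq0 _ y0) /dotv big1// => i _.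
  by rewrite mxE mulr0.
(* Cauchy-Schwarz: the squared length of this vector expands to [2 * a * b * (a * b - d)]. *)
have := dotvv_ge0 (enorm y *: x + (- enorm x) *: y).
rewrite dotv_lin -!sqr_enorm.
set a := enorm x; set b := enorm y; set d := dotv x y => H.
have ab : 0 < a * b by rewrite mulr_gt0// lt0r (x0, y0) enorm_ge0.
rewrite -(ler_pM2l ab); move: H; nra.
Qed.

Lemma enorm_mulmx (M : 'M[R]_n) x : M *m M^T = 1%:M -> enorm (x *m M) = enorm x.
Proof. by move=> MM; rewrite /enorm dotv_mulmx. Qed.

(** Distinct vectors of equal length have a strictly shorter midpoint. For different lengths the
    triangle inequality reduces the claim to strict convexity of the real power. *)
Lemma enorm_midpoint_powR_lt (p : R) x y : 1 < p -> x != y ->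
  enorm (2^-1 *: x + 2^-1 *: y) `^ p < (enorm x `^ p + enorm y `^ p) / 2.
Proof.
move=> p1 xy; set c := enorm _.
have c2 : c ^+ 2 = (2^-1) ^+ 2 * enorm x ^+ 2 + 2 * 2^-1 * 2^-1 * dotv x y
    + (2^-1) ^+ 2 * enorm y ^+ 2 by rewrite /c sqr_enorm dotv_lin !sqr_enorm.
have c0 : 0 <= c by exact: enorm_ge0.
have := enorm_ge0 x; have := enorm_ge0 y.
set a := enorm x in c2 *; set b := enorm y in c2 * => b0 a0.
have [ab|ab] := eqVneq a b.
  have d0 : 0 < enorm (1 *: x + (-1) *: y) ^+ 2.
    by rewrite exprn_gt0// enorm_gt0// scale1r scaleN1r subr_eq0.
  rewrite sqr_enorm dotv_lin -!sqr_enorm -/a -/b -ab in d0.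
  have ca : c < a.
    rewrite -ltr_sqr ?nnegrE// c2 -ab; lra.
  rewrite -ab -[ltRHS](_ : a `^ p = _); last by lra.
  by apply: gt0_ltr_powR => //; rewrite ?nnegrE//; lra.
apply: le_lt_trans (powR_midpoint_lt p a b p1 a0 b0 ab).
apply: ge0_ler_powR; rewrite ?nnegrE//; first lra.
  by rewrite divr_ge0// addr_ge0.
rewrite -ler_sqr ?nnegrE// ?divr_ge0 ?addr_ge0// c2.
have := dotv_le_enorm x y; rewrite -/a -/b; lra.
Qed.

Lemma enorm_midpoint_powR_le (p : R) x y : 1 < p ->
  enorm (2^-1 *: x + 2^-1 *: y) `^ p <= (enorm x `^ p + enorm y `^ p) / 2.
Proof.
move=> p1; have [<-|xy] := eqVneq x y; last exact/ltW/enorm_midpoint_powR_lt.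
rewrite -scalerDl (_ : 2^-1 + 2^-1 = 1) ?scale1r; last by lra.
lra.
Qed.

Lemma measurable_enorm_powR (p : R) (G : 'rV[R]_n -> 'rV[R]_n) :
  measurable_fun setT G -> measurable_fun setT (fun x => enorm (G x) `^ p).
Proof.
move=> mG; apply: (measurableT_comp (measurable_powR p)).
rewrite (_ : (fun _ => _) = (fun x => dotv (G x) (G x) `^ 2^-1)).
  apply: (measurableT_comp (measurable_powR _)).
  exact: (measurableT_comp measurable_dotv).
by apply/funext => x; rewrite powR12_sqrt// dotvv_ge0.
Qed.

End euclidean_norm.

(** * The energy and its equality case at midpoints *)

Section energy.
Context {R : realType} {n : nat} (p : R) (p1 : 1 < p).
Implicit Types (G H : 'rV[R]_n -> 'rV[R]_n).

Local Notation mu := (lebesgue_rV R n).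

Let p0 : 0 < p := lt_trans ltr01 p1.

(** The [p]-th power of [grad_norm]: without the outer root, a pointwise convexity inequality can be
    integrated directly. *)
Definition energy G : \bar R := (\int[mu]_x (enorm (G x) `^ p)%:E)%E.

Lemma energyE G : (grad_norm p G `^ p)%E = energy G.
Proof.
rewrite /grad_norm poweR_Lnorm; last exact: lt0r_neq0.
apply: eq_integral => x _; rewrite gee0_abs ?lee_fin ?enorm_ge0//.
Qed.

Lemma grad_normE G : grad_norm p G = (energy G `^ p^-1)%E.
Proof.
rewrite -energyE -poweRrM mulfV ?poweRe1//; last exact: lt0r_neq0.
exact: Lnorm_ge0.
Qed.

Lemma energy_ge0 G : (0 <= energy G)%E.
Proof. by apply: integral_ge0 => x _; rewrite lee_fin powR_ge0. Qed.

Lemma energy_motion (M : 'M[R]_n) b G : M *m M^T = 1%:M ->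
  measurable_fun setT G ->
  energy (fun x => G (motion M b x) *m M^T) = energy G.
Proof.
move=> MM mG; rewrite /energy.
under eq_integral do rewrite enorm_mulmx ?trmxK ?(mulmx1C MM)//.
rewrite (integral_motion M b (fun x => (enorm (G x) `^ p)%:E))//.
by apply/measurable_EFinP; exact: measurable_enorm_powR.
Qed.

(* Strict convexity of [|.|^p]: if the midpoint has as much energy as the ends,
   the nonnegative convexity gap has integral zero. *)
Lemma energy_midpoint G H : measurable_fun setT G -> measurable_fun setT H ->
  (energy G < +oo)%E -> energy H = energy G ->
  (energy G <= energy (fun x => 2^-1 *: G x + 2^-1 *: H x)%R)%E ->
  energy (fun x => 1 *: G x + (-1) *: H x) = 0%E.
Proof.
move=> mG mH Gfin HG GW; set W := (X in (_ <= energy X)%E) in GW.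
have mZ (a : R) (F : 'rV[R]_n -> 'rV[R]_n) : measurable_fun setT F ->
    measurable_fun setT (fun x => a *: F x).
  move=> mF; apply: measurable_fun_rV => i; under eq_fun do rewrite mxE.
  apply: measurable_funM; first exact: measurable_cst.
  exact: (measurable_coord _ _ _ F i mF).
have mW : measurable_fun setT W.
  exact: (measurable_rVD _ _ _ _ _ (mZ 2^-1 G mG) (mZ 2^-1 H mH)).
pose gap x := (enorm (G x) `^ p + enorm (H x) `^ p) / 2 - enorm (W x) `^ p.
have gap0 x : 0 <= gap x by rewrite subr_ge0; exact: enorm_midpoint_powR_le.
have mgap : measurable_fun setT gap.
  apply: measurable_funB; last exact: measurable_enorm_powR.
  apply: measurable_funM; last exact: measurable_cst.
  by apply: measurable_funD; exact: measurable_enorm_powR.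
have Gf : energy G \is a fin_num by rewrite (ge0_fin_numE (energy_ge0 G)).
(* A sum of nonnegative integrals, not a difference, so that the value of [energy W] may a priori be
   infinite. *)
have gapD : ((\int[mu]_x (gap x)%:E) + energy W = energy G)%E.
  have mpow (F : 'rV[R]_n -> 'rV[R]_n) : measurable_fun setT F ->
      measurable_fun setT (fun x => (enorm (F x) `^ p)%:E).
    by move=> mF; apply/measurable_EFinP; exact: measurable_enorm_powR.
  have pow0 (F : 'rV[R]_n -> 'rV[R]_n) x : setT x -> (0 <= (enorm (F x) `^ p)%:E)%E.
    by rewrite lee_fin powR_ge0.
  have mgapE : measurable_fun setT (fun x => (gap x)%:E) by exact/measurable_EFinP.
  have gap0E x : setT x -> (0 <= (gap x)%:E)%E by rewrite lee_fin.
  rewrite -(ge0_integralD mu measurableT gap0E mgapE (pow0 W) (mpow W mW)).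
  transitivity (\int[mu]_x ((2^-1)%:E *
      ((enorm (G x) `^ p)%:E + (enorm (H x) `^ p)%:E)))%E.
    by apply: eq_integral => x _; rewrite -!EFinD -EFinM subrK mulrC.
  rewrite ge0_integralZl; first last.
  - by rewrite lee_fin.
  - by move=> x xT; exact: (adde_ge0 (pow0 G x xT) (pow0 H x xT)).
  - exact: (emeasurable_funD (mpow G mG) (mpow H mH)).
  - exact: measurableT.
  rewrite (ge0_integralD mu measurableT (pow0 G) (mpow G mG) (pow0 H) (mpow H mH)).
  rewrite -/(energy G) -/(energy H) HG.
  by rewrite -(fineK Gf) -EFinD -EFinM; congr EFin; lra.
(* As [energy W] is at least the finite [energy G], nothing is left for the gap. *)
have int0 : (\int[mu]_x (gap x)%:E = 0)%E.
  have gi0 : (0 <= \int[mu]_x (gap x)%:E)%E by apply: integral_ge0 => x _; rewrite lee_fin.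
  apply: le_anti; rewrite gi0 andbT -(leeD2rE _ _ Gf) add0e -[leRHS]gapD.
  exact: leeD2l.
have gap_ae : ae_eq mu setT (EFin \o gap) (cst 0%E).
  apply/(ae_eq_integral_abs mu measurableT); first exact/measurable_EFinP.
  by rewrite -[RHS]int0; apply: eq_integral => x _; rewrite gee0_abs ?lee_fin.
pose V x := (enorm (1 *: G x + (-1) *: H x) `^ p)%:E.
have mV : measurable_fun setT V.
  apply/measurable_EFinP; apply: measurable_enorm_powR.
  exact: (measurable_rVD _ _ _ _ _ (mZ 1 G mG) (mZ (-1) H mH)).
(* Wherever the gap vanishes, strictness forces [G x = H x]. *)
have V0 : ae_eq mu setT V (cst 0%E).
  move: gap_ae; apply: filterS => x /(_ I) /= [gx] _.
  have [GHx|GHx] := eqVneq (G x) (H x).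
    by rewrite /V GHx scale1r scaleN1r subrr enorm0 (powR0 (lt0r_neq0 p0)).
  have := enorm_midpoint_powR_lt p _ _ p1 GHx.
  by rewrite -subr_gt0 -/(gap x) gx ltxx.
have := ae_eq_integral (cst 0%E) V measurableT mV (measurable_cst _) V0.
by rewrite integral0.
Qed.

End energy.

(** * Admissibility of the sharp constant *)

Section morrey_constant.
Context {R : realType} {n : nat} (p : R).
Implicit Types (u : 'rV[R]_n -> R) (G : 'rV[R]_n -> 'rV[R]_n).

Lemma hoelder_quotient_le u (x y : 'rV[R]_n) : x != y ->
  ((hoelder_quotient p u x y)%:E <= hoelder_seminorm p u)%E.
Proof. by move=> xy; apply: ereal_sup_ubound; exists x, y. Qed.

Lemma hoelder_seminorm_le0 u : (hoelder_seminorm p u <= 0)%E ->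
  forall x y, u x = u y.
Proof.
move=> u0 x y; have [->//|xy] := eqVneq x y.
have := le_trans (hoelder_quotient_le u x y xy) u0.
rewrite lee_fin /hoelder_quotient pmulr_lle0; last first.
  by rewrite invr_gt0 powR_gt0// enorm_gt0// subr_eq0.
by rewrite normr_le0 subr_eq0 => /eqP.
Qed.

(** For a finite gradient norm the bound passes to the limit along admissible constants; for an
    infinite one the right side is infinite because the constant is positive. *)
Lemma morrey_constant_bound : 0 < morrey_constant n p ->
  morrey_bound n p (morrey_constant n p).
Proof.
set C := morrey_constant n p => C0 u G uG.
(* Without a genuine infimum [inf] would take its default value [0]. *)
have hC : has_inf [set C | morrey_bound n p C].
  by apply: contrapT => /inf_out E; move: C0; rewrite /C /morrey_constant E ltxx.
have N0 : (0 <= grad_norm p G)%E by exact: Lnorm_ge0.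
case E : (grad_norm p G) => [r| |]; last by rewrite E in N0.
- have r0 : 0 <= r by rewrite E lee_fin in N0.
  apply/lee_addgt0Pr => e e0.
  (* The tolerance is divided by [r + 1] because [r] may be [0]. *)
  have r1 : 0 < r + 1 by rewrite ltr_wpDl.
  have [C' C'b C'lt] := inf_adherent (divr_gt0 e0 r1) hC.
  apply: (le_trans (C'b u G uG)); rewrite E -EFinM -EFinD lee_fin.
  apply: (@le_trans _ _ ((C + e / (r + 1)) * r)).
    by rewrite ler_wpM2r// ltW.
  by rewrite mulrDl lerD2l mulrAC ler_pdivrMr// ler_pM2l// lerDl.
- by rewrite gt0_muley ?lte_fin// leey.
Qed.

End morrey_constant.

(** * Rotational symmetry of extremals *)

Theorem corollary3p3 (R : realType) (n : nat) (p : R) (x0 y0 : 'rV[R]_n)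
    (u : 'rV[R]_n -> R) (Q : {linear 'rV[R]_n -> 'rV[R]_n}) :
  (1 <= n)%N -> n%:R < p ->
  x0 != y0 ->
  D1p p u -> morrey_extremal p u ->
  hoelder_seminorm p u = (hoelder_quotient p u x0 y0)%:E ->
  orthogonal_transformation Q -> Q (y0 - x0) = y0 - x0 ->
  forall x : 'rV[R]_n, u x = u (Q (x - x0) + x0).
Proof.
move=> n1 np xy0 _ [G uG uext] uxy Qorth Qfix.
have p1 : 1 < p by rewrite (le_lt_trans _ np)// ler1n.
have N0 F : (0 <= grad_norm p (F : 'rV[R]_n -> 'rV[R]_n))%E by exact: Lnorm_ge0.
set C := morrey_constant n p in uext.
have [C0|C0] := leP C 0.
  have u0 : (hoelder_seminorm p u <= 0)%E by rewrite uext mule_le0_ge0// lee_fin.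
  by move=> x; exact: (hoelder_seminorm_le0 p u u0).
have Cbound : morrey_bound n p C by exact: morrey_constant_bound.
pose M := lin1_mx Q; have QE x : Q x = x *m M by rewrite mul_rV_lin1.
(* Orthogonality of [Q], tested on pairs of basis vectors, gives the entries of [M *m M^T]. *)
have MM : M *m M^T = 1%:M.
  apply/matrixP => i j.
  have := Qorth (delta_mx ord0 i) (delta_mx ord0 j).
  rewrite !QE !dotvE trmx_mul mulmxA -(mulmxA (delta_mx ord0 i)).
  rewrite -rowE trmx_delta -!colE => E.
  transitivity (col j (row i (M *m M^T)) ord0 ord0).
    by rewrite [RHS]mxE [RHS]mxE.
  by rewrite E !mxE eqxx /= eq_sym.
pose b := x0 - x0 *m M; pose v := u \o motion M b.
have TE x : Q (x - x0) + x0 = motion M b x.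
  by rewrite QE /motion mulmxBl addrAC addrA.
have vx0 : v x0 = u x0 by rewrite /v/= -TE subrr linear0 add0r.
have vy0 : v y0 = u y0 by rewrite /v/= -TE Qfix subrK.
pose H x := G (motion M b x) *m M^T.
have vH : D1p_gradient p v H by exact: (D1p_gradient_motion p (ltW p1)).
have mG F f : D1p_gradient p f F -> measurable_fun setT (F : 'rV[R]_n -> 'rV[R]_n).
  by move=> [_ _ fF _]; apply: measurable_fun_rV => i; have [_ []] := fF i.
pose w x := 2^-1 * u x + 2^-1 * v x.
have wW := D1p_gradient_lin p (ltW p1) 2^-1 2^-1 _ _ _ _ uG vH.
have wxy : hoelder_quotient p w x0 y0 = hoelder_quotient p u x0 y0.
  rewrite /hoelder_quotient /w vx0 vy0; congr (`| _ | / _).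
  by lra.
(* The chain is [C ||Du|| = [u]], which is the quotient of [u] and so of [w] at [x0, y0], at most
   [[w]], at most [C ||Dw||]; then [C > 0] is cancelled. *)
have GW : (grad_norm p G <= grad_norm p (fun x => 2^-1 *: G x + 2^-1 *: H x)%R)%E.
  have Cf : C%:E \is a fin_num by [].
  have C0' : (0 < C%:E)%E by rewrite lte_fin.
  rewrite -(lee_pmul2l Cf C0') -uext uxy -wxy.
  exact: (le_trans (hoelder_quotient_le p w x0 y0 xy0) (Cbound _ _ wW)).
(* The seminorm equals a real quotient, so with [C > 0] the gradient norm cannot be infinite. *)
have Gfin : (grad_norm p G < +oo)%E.
  rewrite ltey; apply/eqP => Goo; move: uxy.
  by rewrite uext Goo gt0_muley ?lte_fin.
have p0 : 0 < p := lt_trans ltr01 p1.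
have HG : energy p H = energy p G by exact: energy_motion MM (mG _ _ uG).
have dE : energy p (fun x => 1 *: G x + (-1) *: H x) = 0%E.
  apply: (energy_midpoint p p1 G H (mG _ _ uG) (mG _ _ vH) _ HG).
    by rewrite -(energyE p p1 G); exact: poweR_lty.
  rewrite -(energyE p p1 G) -(energyE p p1 (fun x => 2^-1 *: G x + 2^-1 *: H x)).
  apply: (gt0_ler_poweR (ltW p0)); last exact: GW.
  - by rewrite in_itv/= N0 leey.
  - by rewrite in_itv/= N0 leey.
have dD := D1p_gradient_lin p (ltW p1) 1 (-1) _ _ _ _ uG vH.
have d0 : (hoelder_seminorm p (fun x => 1 * u x + (-1) * v x)%R <= 0)%E.
  apply: (le_trans (Cbound _ _ dD)).
  (* A nonzero exponent is what makes the root of zero energy equal to [0]. *)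
  have pV0 : p^-1 != 0 by exact: invr_neq0 (lt0r_neq0 p0).
  rewrite (grad_normE p p1) dE.
  by rewrite (poweR0r pV0) mule0.
move=> x; have := hoelder_seminorm_le0 p _ d0 x x0.
rewrite vx0 !mul1r !mulN1r subrr TE => /eqP.
by rewrite subr_eq0 => /eqP.
Qed.
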